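(* There exists an absolute constant $c>0$ such that the following holds. Let $\mathcal P\subset\mathbb R^2$ be a set of $m$ points and $\mathcal Q\subset\mathbb R^2$ a set of $n$ points with $2\le m\le n^{1/3}$. Then there exists $p\in\mathcal P$ such that $|\{d(p,q): q\in\mathcal Q\}|\ge c\sqrt{mn}$.
   Context: $d$ denotes the Euclidean distance in $\mathbb R^2$. *)

(* Defs.v *)
From mathcomp Require Import all_boot all_order all_algebra finmap.
From mathcomp Require Import reals exp.
Set Implicit Arguments.
Unset Strict Implicit.
Unset Printing Implicit Defensive.
Import Order.TTheory GRing.Theory Num.Theory.
Local Open Scope ring_scope.

(* The library's norm on R * R is the sup norm, hence this definition. *)
Definition eucl_dist (R : realType) (p q : R * R) : R :=
  Num.sqrt ((p.1 - q.1) ^+ 2 + (p.2 - q.2) ^+ 2).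

(* Main.v *)
Require Import Defs.
From mathcomp Require Import all_boot all_order all_algebra finmap.
From mathcomp Require Import boolp reals exp.
From mathcomp Require Import topology normedtype realfun.
From mathcomp Require Import zify ring lra.
Import Order.TTheory GRing.Theory Num.Theory.
Import numFieldNormedType.Exports.
Local Open Scope fset_scope.
Local Open Scope ring_scope.

(* Suppose every p in P sees at most D distances. Cut the circles about the
   points of P carrying the points of Q into arcs between consecutive points of Q
   on the same half circle, and discard the arcs about p that meet one of the lines
   pp' with p' in P. At most O(m^2 D) of the mn incidences are lost, which is a small
   fraction of mn because m <= n^(1/3). Two circles about p and p' are mirror
   symmetric in pp', so they meet at most once on each side of this line; hence
   the remaining arcs form a simple graph drawn on Q in which edges with a common
   endpoint do not cross and which has at most O(m^2 D^2) crossings. The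
   crossing lemma then gives D^2 >= c m n. *)

(** * The crossing lemma for x-monotone drawings *)

(** The obstacle is multiplicity: two points may be joined by arcs of many circles, and the crossing
    bound fails for multigraphs; removing the arcs that meet lines of centres serves to exclude
    this. Half circles are used because an arc on one of them is the graph of a function of the
    abscissa. A drawing then reduces to the heights of its edges above and below the vertices, and
    the linear bound for noncrossing edges becomes a charging argument that needs neither the Jordan
    curve theorem nor Euler's formula. The exponent 1/3 is what the loss demands: if [D ^ 2] is
    small against [m n], then [m ^ 2 D] is small against [m n] as soon as [m ^ 3 <= n]. The constant
    1/100 has slack: the final comparison needs only [8 * 24 ^ 2 < 100 ^ 2]. *)

(** Counting by codes: [r s t] reads [t] is a code of [s]. A relation lets later codes mention
    existential witnesses, such as a crossing point, without choosing them. *)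
Lemma leq_card_rel (S T : finType) (A : {set S}) (B : {set T})
    (r : S -> T -> Prop) :
  (forall s, s \in A -> exists2 t, t \in B & r s t) ->
  (forall s s' t, s \in A -> s' \in A -> r s t -> r s' t -> s = s') ->
  (#|A| <= #|B|)%N.
Proof.
move=> ex inj.
have [s0 s0A|A0] := pickP (mem A); last by rewrite eq_card0.
have [t0 _ _] := ex _ s0A.
have /choice [f fP] : forall s, exists t, s \in A -> t \in B /\ r s t.
  move=> s; have [/ex[t tB rst]|_] := boolP (s \in A); first by exists t.
  by exists t0.
rewrite -(@card_in_imset _ _ f A); last first.
  move=> s s' sA s'A eqf; have [_ r1] := fP _ sA; have [_ r2] := fP _ s'A.
  by apply: (inj _ _ (f s)) => //; rewrite eqf.
by apply/subset_leq_card/subsetP => _ /imsetP[s sA ->]; have [] := fP _ sA.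
Qed.

(** * Linear bound for noncrossing edges *)

Section PlanarBound.
Variables (d : Order.disp_t) (R : orderType d) (V E : finType).
(** [height e v] stands for the ordinate of the edge [e] on the vertical line through [v]. Only the
    order of such values matters, so [R] is a mere ordered type. *)
Variables (vx vy : V -> R) (src tgt : E -> V) (height : E -> V -> R).
Variables (S : {set V}) (F : {set E}).

Hypothesis vx_inj : injective vx.
Hypothesis srcS : forall e, e \in F -> src e \in S.
Hypothesis tgtS : forall e, e \in F -> tgt e \in S.
Hypothesis src_lt_tgt : forall e, e \in F -> (vx (src e) < vx (tgt e))%O.
Hypothesis height_src : forall e, e \in F -> height e (src e) = vy (src e).
Hypothesis height_tgt : forall e, e \in F -> height e (tgt e) = vy (tgt e).
Hypothesis edge_avoids : forall e v, e \in F ->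
  (vx (src e) < vx v)%O -> (vx v < vx (tgt e))%O -> height e v <> vy v.
Hypothesis edge_simple : forall e g, e \in F -> g \in F ->
  src e = src g -> tgt e = tgt g -> e = g.
(** The conclusion is weak because two edges may meet at a common endpoint; contact in the interior
    of both is left to [height_inj]. *)
Hypothesis height_order : forall e g v w, e \in F -> g \in F ->
  (vx (src e) <= vx v <= vx (tgt e))%O -> (vx (src g) <= vx v <= vx (tgt g))%O ->
  (vx (src e) <= vx w <= vx (tgt e))%O -> (vx (src g) <= vx w <= vx (tgt g))%O ->
  (height e v < height g v)%O -> (height e w <= height g w)%O.
Hypothesis height_inj : forall e g v, e \in F -> g \in F ->
  (vx (src e) < vx v < vx (tgt e))%O -> (vx (src g) < vx v < vx (tgt g))%O ->
  height e v = height g v -> e = g.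

(** Every edge of [F] leaving [v] reaches the abscissa of this [w], so the edges leaving [v] can all
    be compared there. *)
Let next_vertex (v w : V) := w \in S /\ (vx v < vx w)%O /\
  forall u, u \in S -> (vx v < vx u)%O -> (vx w <= vx u)%O.

(** Mind the order of arguments: [g] is the upper edge. *)
Let above (e g : E) := [/\ e \in F, g \in F, src e = src g &
  forall v, next_vertex (src e) v -> (height e v < height g v)%O].

Let next_above (e g : E) := above e g /\
  forall g', above e g' -> ~ above g' g.

(** Closed above, below and on the right, so that the right end that comes first is in the wedge and
    a tip exists. *)
Let in_wedge (e g : E) (w : V) :=
  [/\ w \in S, (vx (src e) < vx w)%O, (vx w <= vx (tgt e))%O,
     (vx w <= vx (tgt g))%O & (height e w <= vy w <= height g w)%O].

Let wedge_tip (e g : E) (w : V) := in_wedge e g w /\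
  forall u, in_wedge e g u -> (vx w <= vx u)%O.

Let ex_next_vertex e : e \in F -> exists v, next_vertex (src e) v.
Proof.
move=> eF; pose P v := (v \in S) && (vx (src e) < vx v)%O.
have P0 : P (tgt e) by rewrite /P tgtS ?src_lt_tgt.
case: (@arg_minP _ _ _ (tgt e) P vx P0) => v /andP[vS lt] vmin.
by exists v; split=> //; split=> // u uS ltu; apply: vmin; apply/andP.
Qed.

Let next_vertex_le_tgt e v : e \in F -> next_vertex (src e) v ->
  (vx (src e) <= vx v <= vx (tgt e))%O.
Proof.
move=> eF [vS [lt vmin]]; rewrite (ltW lt) /=; apply: vmin; first exact: tgtS.
exact: src_lt_tgt.
Qed.

Let next_vertex_uniq v w w' : next_vertex v w -> next_vertex v w' -> w = w'.
Proof.
move=> [wS [lt wmin]] [w'S [lt' w'min]]; apply: vx_inj; apply/eqP.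
by rewrite eq_le wmin ?w'min.
Qed.

Let src_total e g : e \in F -> g \in F -> src e = src g -> e <> g ->
  above e g \/ above g e.
Proof.
move=> eF gF se ne; have [v nv] := ex_next_vertex _ eF.
have nvg := nv; rewrite se in nvg.
have lee := next_vertex_le_tgt _ _ eF nv.
have leg := next_vertex_le_tgt _ _ gF nvg.
have lt : (vx (src e) < vx v)%O by case: nv => _ [].
have ltg : (vx (src g) < vx v)%O by rewrite -se.
have neh : height e v != height g v.
  apply/eqP => eqh; apply: ne.
  (* Equal heights at [v] fail in each case: if both edges end there they are parallel, if one does
     its end lies on the other, and if none does they touch in their interiors. *)
  move: (lee) (leg) => /andP[_ le1] /andP[_ le2].
  move: le1; rewrite le_eqVlt => /orP[/eqP/vx_inj ve|lt1];
  move: le2; rewrite le_eqVlt => /orP[/eqP/vx_inj vg|lt2].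
  - by apply: edge_simple => //; rewrite -ve.
  - by case: (edge_avoids _ _ gF ltg lt2); rewrite -eqh ve height_tgt.
  - by case: (edge_avoids _ _ eF lt lt1); rewrite eqh vg height_tgt.
  - by apply: (height_inj _ _ v) => //; rewrite ?lt ?ltg.
case: (ltgtP (height e v) (height g v)) neh => // ltv _; [left|right]; split=> // u nu.
  by rewrite (next_vertex_uniq _ _ _ nu nv).
by rewrite (next_vertex_uniq _ _ _ nu nvg).
Qed.

Let above_ne e g : above e g -> e <> g.
Proof.
move=> [eF gF _ H] eq; subst g; have [v /H] := ex_next_vertex _ eF.
by rewrite ltxx.
Qed.

Let above_at e g w : above e g -> (vx (src e) <= vx w)%O ->
  (vx w <= vx (tgt e))%O -> (vx w <= vx (tgt g))%O ->
  (height e w <= height g w)%O.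
Proof.
move=> [eF gF se H] l1 l2 l3; have [v nv] := ex_next_vertex _ eF.
have nvg := nv; rewrite se in nvg.
apply: (height_order _ _ v) => //.
- exact: next_vertex_le_tgt.
- exact: next_vertex_le_tgt.
- by rewrite l1.
- by rewrite -se l1.
- exact: H.
Qed.

Let ex_next_above e g : above e g -> exists g', next_above e g'.
Proof.
move=> ab; have [eF _ se _] := ab; have [v nv] := ex_next_vertex _ eF.
pose P h := `[< above e h >].
have P0 : P g by apply/asboolP.
case: (@arg_minP _ _ _ g P (height^~ v) P0) => h /asboolP abh hmin.
exists h; split=> // g' abg' [_ _ _ H].
have /hmin : P g' by apply/asboolP.
by rewrite leNgt H //; case: abg' => _ _ <-.
Qed.

Let ex_wedge_tip e g : above e g -> exists w, wedge_tip e g w.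
Proof.
move=> ab; have [eF gF se _] := ab.
have [w0 w0P] : exists w, in_wedge e g w.
  case: (leP (vx (tgt e)) (vx (tgt g))) => [le|/ltW le].
    exists (tgt e); split; rewrite ?tgtS ?src_lt_tgt //.
    by rewrite -height_tgt // lexx above_at // ltW ?src_lt_tgt.
  exists (tgt g); split; rewrite ?tgtS ?se ?src_lt_tgt //.
  by rewrite -height_tgt // lexx above_at // se ltW ?src_lt_tgt.
pose P w := `[< in_wedge e g w >].
have P0 : P w0 by apply/asboolP.
case: (@arg_minP _ _ _ w0 P vx P0) => w /asboolP wP wmin.
by exists w; split=> // u uP; apply: wmin; apply/asboolP.
Qed.

(* An edge inside the wedge at its tip either starts in the wedge, or at the
   apex, or passes through the apex. *)
Let wedge_empty e g w h : next_above e g -> wedge_tip e g w -> h \in F ->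
  (vx (src h) < vx w)%O -> (vx w <= vx (tgt h))%O ->
  (height e w < height h w)%O -> (height h w < height g w)%O -> False.
Proof.
move=> [ab nab] [[wS lt l1 l2 /andP[wy1 wy2]] wmin] hF hw wh eh hg.
have [eF gF se _] := ab.
have le := ltW lt.
have gle : (vx (src g) <= vx w)%O by rewrite -se.
(* The strict order at [w] propagates to the left by noncrossing, so [h] stays between [e] and [g]
   as far back as it shares abscissae with them. *)
have inter u : (vx (src h) <= vx u)%O -> (vx (src e) <= vx u)%O ->
    (vx u <= vx w)%O -> (height e u <= height h u <= height g u)%O.
  move=> u1 u2 u3; have u4 : (vx (src g) <= vx u)%O by rewrite -se.
  apply/andP; split; apply: (height_order _ _ w) => //;
    by rewrite ?le ?gle ?(ltW hw) ?l1 ?l2 ?wh ?u1 ?u2 ?u4 ?(le_trans u3).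
case: (ltgtP (vx (src h)) (vx (src e))) => [lth|gth|/vx_inj eqs].
- have := inter (src e) (ltW lth) (lexx _) le.
  rewrite (height_src e) // [X in height g X]se (height_src g) // -se => /le_anti eqh.
  by case: (edge_avoids _ _ hF lth (lt_le_trans lt wh)); rewrite eqh.
- have := inter (src h) (lexx _) (ltW gth) (ltW hw); rewrite height_src // => ih.
  have /wmin : in_wedge e g (src h).
    by split; rewrite ?srcS //; apply: le_trans (ltW hw) _.
  by rewrite leNgt hw.
- have [] : above e h \/ above h e.
  + apply: src_total => // eq; by rewrite eq ltxx in eh.
  + move=> abh.
    have [] : above h g \/ above g h.
    * apply: src_total => //; first by rewrite -se.
      by move=> eq; rewrite eq ltxx in hg.
    * exact: nab.
    * move=> /above_at-/(_ w); rewrite -se => /(_ le l2 wh).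
      by rewrite leNgt hg.
  + move=> /above_at-/(_ w); rewrite eqs => /(_ le wh l1).
    by rewrite leNgt eh.
Qed.

Let charge (e : E) (wb : V * bool) := exists g,
  [/\ next_above e g, wedge_tip e g wb.1 & (vy wb.1 < height g wb.1)%O = wb.2].

(** If [w] is strictly below both [g] and [g'], the lower of the two would enter the other wedge at
    its tip; hence [g = g'], and an edge has only one predecessor. Otherwise [w] is the right end of
    both, [e] and [e'] pass strictly below it, and the higher of these would enter the other
    wedge. *)
Let charge_inj e e' wb : charge e wb -> charge e' wb -> e = e'.
Proof.
case: wb => w b [g [na /= tip bE]] [g' [na' /= tip' bE']].
have [[ab nab] [ab' nab']] := (na, na').
have [[eF gF se H] [e'F g'F se' H']] := (ab, ab').
have [[[wS lt l1 l2 /andP[y1 y2]] _] [[_ lt' l1' l2' /andP[y1' y2']] _]] :=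
  (tip, tip').
have ltg : (vx (src g) < vx w)%O by rewrite -se.
have ltg' : (vx (src g') < vx w)%O by rewrite -se'.
case: b bE bE' => [yg yg'|/negbT yg /negbT yg'].
  have wg k : k \in F -> (vx w <= vx (tgt k))%O -> (vy w < height k w)%O ->
      (vx w < vx (tgt k))%O.
    move=> kF; rewrite le_eqVlt => /orP[/eqP/vx_inj->|//].
    by rewrite height_tgt // ltxx.
  have [eqg|/eqP neg] := g =P g'.
    subst g'; apply: contrapT => ne.
    have [] : above e e' \/ above e' e by apply: src_total => //; rewrite se'.
    - by move=> /nab; apply.
    - by move=> /nab'; apply.
  case: (ltgtP (height g w) (height g' w)) => [hlt|hlt|heq].
  - by case: (wedge_empty _ _ _ g na' tip') => //; apply: le_lt_trans yg.
  - by case: (wedge_empty _ _ _ g' na tip) => //; apply: le_lt_trans yg'.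
  - by case/eqP: neg; apply: (height_inj _ _ w) => //; rewrite ?ltg ?ltg' wg.
have below k h : above k h -> (vx (src k) < vx w)%O -> (vx w <= vx (tgt k))%O ->
    (vx w <= vx (tgt h))%O -> (height k w <= vy w)%O -> (vy w <= height h w)%O ->
    ~~ (vy w < height h w)%O ->
    [/\ (height k w < vy w)%O, height h w = vy w & (vx w < vx (tgt k))%O].
  move=> abk k1 k2 k3 k4 k5; rewrite -leNgt => k6.
  have [kF hF sk _] := abk.
  have hw : height h w = vy w by apply/le_anti; rewrite k5 k6.
  have wh : w = tgt h.
    move: k3; rewrite le_eqVlt => /orP[/eqP/vx_inj//|k3].
    by case: (edge_avoids _ _ hF _ k3) => //; rewrite -sk.
  have wk : (vx w < vx (tgt k))%O.
    rewrite lt_neqAle k2 andbT; apply/eqP => /vx_inj eqw.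
    by apply: (above_ne _ _ abk); apply: edge_simple => //; rewrite -wh.
  split=> //; rewrite lt_neqAle k4 andbT; apply/eqP.
  exact: edge_avoids.
have [e1 e2 e3] := below _ _ ab lt l1 l2 y1 y2 yg.
have [e1' e2' e3'] := below _ _ ab' lt' l1' l2' y1' y2' yg'.
case: (ltgtP (height e w) (height e' w)) => [hlt|hlt|heq].
- by case: (wedge_empty _ _ _ e' na tip) => //; rewrite e2.
- by case: (wedge_empty _ _ _ e na' tip') => //; rewrite e2'.
- by apply: (height_inj _ _ w) => //; rewrite ?lt ?lt' ?e3 ?e3'.
Qed.

(* Order the edges leaving a vertex to the right from bottom to top. An edge [e]
   that is not the topmost one forms a wedge with its successor [g]; charge [e]
   to the leftmost vertex [w] of that wedge. Then [g] is the edge seen from [w]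
   vertically upwards, or [e] is the edge seen downwards. *)
Lemma card_noncrossing_edges : (#|F| <= 3 * #|S|)%N.
Proof.
pose top := [set e in F | `[< forall g, ~ above e g >]].
have top_le : (#|top| <= #|S|)%N.
  apply: (@leq_card_rel _ _ _ _ (fun e v => src e = v)).
    by move=> e; rewrite inE => /andP[eF _]; exists (src e) => //; apply: srcS.
  move=> e e' v; rewrite !inE => /andP[eF /asboolP te] /andP[e'F /asboolP te'].
  move=> sv sv'; apply: contrapT => ne.
  have [] : above e e' \/ above e' e by apply: src_total => //; rewrite sv.
  - exact: te.
  - exact: te'.
(* Two charges per vertex, and one topmost edge per source, make the factor 3. *)
have rest_le : (#|F :\: top| <= #|setX S [set: bool]|)%N.
  apply: (@leq_card_rel _ _ _ _ charge); last by move=> e e' wb _ _; apply: charge_inj.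
  move=> e; rewrite !inE => /andP[nt eF]; move: nt; rewrite eF /=.
  move=> /asboolPn/existsNP[g /contrapT ab].
  have [h nh] := ex_next_above _ _ ab.
  have [w wt] := ex_wedge_tip _ _ nh.1.
  exists (w, (vy w < height h w)%O); first by rewrite in_setX inE andbT; case: wt => -[].
  by exists h.
rewrite cardsX cardsT card_bool in rest_le.
have := cardsID top F.
have : (#|F :&: top| <= #|top|)%N by rewrite subset_leq_card ?subsetIr.
lia.
Qed.

End PlanarBound.

(** * Random induced subgraphs *)

(** A uniformly random [phi] keeps [v] when [phi v] is 0. This is the probability
    [1 / k.+1 ^ size s] of keeping all of [s], with the denominators cleared to stay in [nat]. *)
Lemma card_sample (V : finType) (k : nat) (s : seq V) : uniq s ->
  (#|[set phi : {ffun V -> 'I_k.+1} | all (fun v => phi v == ord0) s]|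
     * k.+1 ^ size s = k.+1 ^ #|V|)%N.
Proof.
move=> us.
pose G v : pred 'I_k.+1 := if v \in s then pred1 ord0 else predT.
have -> : #|[set phi : {ffun V -> 'I_k.+1} | all (fun v => phi v == ord0) s]|
    = #|family G|.
  apply: eq_card => phi; rewrite inE; apply/allP/familyP => H v.
    by rewrite /G; case: ifP => // /H.
  by move=> vs; have := H v; rewrite /G vs.
rewrite card_family foldrE big_map big_enum /= (bigID (mem s)) /=.
rewrite big1 ?mul1n; last by move=> v vs; rewrite /G vs card1.
rewrite (eq_bigr (fun=> k.+1)); last first.
  by move=> v /negbTE vs; rewrite /G vs cardT size_enum_ord.
rewrite prod_nat_const -expnD; congr (_ ^ _)%N.
by rewrite -(card_uniqP us) addnC -(cardC (mem s)); congr (_ + _)%N; apply: eq_card.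
Qed.

(** Linearity of expectation, by exchanging the two sums. *)
Lemma sum_card_sample (V T : finType) (k r : nat) (A : {set T}) (s : T -> seq V) :
  (forall t, t \in A -> uniq (s t) /\ size (s t) = r) ->
  ((\sum_(phi : {ffun V -> 'I_k.+1})
      #|[set t in A | all (fun v => phi v == ord0) (s t)]|) * k.+1 ^ r
   = #|A| * k.+1 ^ #|V|)%N.
Proof.
move=> us; rewrite (eq_bigr (fun phi : {ffun V -> 'I_k.+1} =>
  \sum_(t in A) (all (fun v => phi v == ord0) (s t) : nat))%N); last first.
  move=> phi _; rewrite -sum1_card big_mkcond [RHS]big_mkcond /=.
  by apply: eq_bigr => t _; rewrite inE; case: (t \in A); case: all.
rewrite exchange_big /= big_distrl /= -sum_nat_const; apply: eq_bigr => t tA.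
have [ut st] := us _ tA; rewrite -(card_sample _ _ _ ut) st; congr (_ * _)%N.
rewrite -sum1_card [RHS]big_mkcond /=.
by apply: eq_bigr => phi _; rewrite inE; case: all.
Qed.

Section CrossingBound.
Variables (d : Order.disp_t) (R : orderType d) (V E : finType).
Variables (vx vy : V -> R) (src tgt : E -> V) (height : E -> V -> R).
Variables (F : {set E}) (cross : rel E).

Hypothesis vx_inj : injective vx.
Hypothesis src_lt_tgt : forall e, e \in F -> (vx (src e) < vx (tgt e))%O.
Hypothesis height_src : forall e, e \in F -> height e (src e) = vy (src e).
Hypothesis height_tgt : forall e, e \in F -> height e (tgt e) = vy (tgt e).
Hypothesis edge_avoids : forall e v, e \in F ->
  (vx (src e) < vx v)%O -> (vx v < vx (tgt e))%O -> height e v <> vy v.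
Hypothesis edge_simple : forall e g, e \in F -> g \in F ->
  src e = src g -> tgt e = tgt g -> e = g.
Hypothesis height_order : forall e g v w, e \in F -> g \in F -> ~~ cross e g ->
  (vx (src e) <= vx v <= vx (tgt e))%O -> (vx (src g) <= vx v <= vx (tgt g))%O ->
  (vx (src e) <= vx w <= vx (tgt e))%O -> (vx (src g) <= vx w <= vx (tgt g))%O ->
  (height e v < height g v)%O -> (height e w <= height g w)%O.
Hypothesis height_inj : forall e g v, e \in F -> g \in F -> ~~ cross e g ->
  (vx (src e) < vx v < vx (tgt e))%O -> (vx (src g) < vx v < vx (tgt g))%O ->
  height e v = height g v -> e = g.
(** Four distinct ends are what makes a crossing survive the sampling with probability [1 / k ^ 4]
    only. *)
Hypothesis cross_disjoint : forall e g, e \in F -> g \in F -> cross e g ->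
  uniq [:: src e; tgt e; src g; tgt g].

Let crossings := [set eg : E * E | [&& eg.1 \in F, eg.2 \in F & cross eg.1 eg.2]].

(** Delete each induced edge that comes first in a crossing pair of induced edges. This costs at
    most one edge per pair, and the rest is noncrossing. *)
Let card_induced_edges (S : {set V}) :
  (#|[set e in F | all (mem S) [:: src e; tgt e]]| <=
   3 * #|S| + #|[set eg in crossings |
     all (mem S) [:: src eg.1; tgt eg.1; src eg.2; tgt eg.2]]|)%N.
Proof.
set FS := [set e in F | _]; set XS := [set eg in _ | _].
pose bad := [set e in FS | [exists g in FS, cross e g]].
have bad_le : (#|bad| <= #|XS|)%N.
  apply: (@leq_card_rel _ _ _ _ (fun e eg => eg.1 = e)); last by move=> e e' eg _ _ <-.
  move=> e; rewrite inE => /andP[eFS /existsP[g /andP[gFS cr]]].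
  exists (e, g) => //; move: eFS gFS; rewrite !inE /= !andbT cr andbT.
  by move=> /and3P[-> -> ->] /and3P[-> -> ->].
have inF e : e \in FS :\: bad -> [/\ e \in F, src e \in S & tgt e \in S].
  by rewrite !inE /= andbT => /andP[_ /and3P[-> -> ->]].
have good e g : e \in FS :\: bad -> g \in FS :\: bad -> ~~ cross e g.
  rewrite [e \in _]inE [e \in bad]inE => /andP[+ eFS] /setDP[gFS _]; rewrite eFS /=.
  by move=> /existsPn/(_ g); rewrite gFS.
have := @card_noncrossing_edges _ R V E vx vy src tgt height S (FS :\: bad) vx_inj.
have -> : #|FS :\: bad| = (#|FS| - #|bad|)%N.
  by rewrite cardsD (setIidPr _) //; apply/subsetP => e; rewrite inE => /andP[].
move=> H; suff : (#|FS| - #|bad| <= 3 * #|S|)%N by lia.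
apply: H.
- by move=> e /inF[].
- by move=> e /inF[].
- by move=> e /inF[/src_lt_tgt].
- by move=> e /inF[/height_src].
- by move=> e /inF[/height_tgt].
- by move=> e v /inF[eF _ _]; apply: edge_avoids.
- by move=> e g /inF[eF _ _] /inF[gF _ _]; apply: edge_simple.
- move=> e g v w eG gG; have [eF _ _] := inF _ eG; have [gF _ _] := inF _ gG.
  by apply: height_order => //; apply: good.
- move=> e g v eG gG; have [eF _ _] := inF _ eG; have [gF _ _] := inF _ gG.
  by apply: height_inj => //; apply: good.
Qed.

(* Apply the planar bound to a random induced subgraph that keeps each vertex
   with probability 1/k. *)
Lemma crossing_lemma (k : nat) : (0 < k)%N ->
  (#|F| * k ^ 2 <= 3 * #|V| * k ^ 3 + #|crossings|)%N.
Proof.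
case: k => // k _; pose keep (phi : {ffun V -> 'I_k.+1}) v := phi v == ord0.
have eE := @sum_card_sample V E k 2 F (fun e => [:: src e; tgt e]).
have xE := @sum_card_sample V _ k 4 crossings
  (fun eg => [:: src eg.1; tgt eg.1; src eg.2; tgt eg.2]).
have vE := @sum_card_sample V V k 1 [set: V] (fun v => [:: v]).
have : (\sum_(phi : {ffun V -> 'I_k.+1})
      #|[set e in F | all (keep phi) [:: src e; tgt e]]| <=
    3 * \sum_(phi : {ffun V -> 'I_k.+1})
      #|[set v in [set: V] | all (keep phi) [:: v]]|
    + \sum_(phi : {ffun V -> 'I_k.+1}) #|[set eg in crossings | all (keep phi)
      [:: src eg.1; tgt eg.1; src eg.2; tgt eg.2]]|)%N.
  rewrite big_distrr -big_split /=; apply: leq_sum => phi _.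
  set SV := [set v in [set: V] | _].
  have SE v : (v \in SV) = keep phi v by rewrite !inE /= andbT.
  have allE s : all (mem SV) s = all (keep phi) s by apply: eq_all => v; apply: SE.
  have := card_induced_edges SV.
  by congr (_ <= _ + _)%N; apply: eq_card => x; rewrite !inE allE.
move: eE xE vE; rewrite /keep cardsT.
set sE := (\sum_phi _)%N; set sX := (\sum_phi _)%N; set sV := (\sum_phi _)%N.
move=> eE xE vE sum_le.
have {}eE : (sE * k.+1 ^ 2 = #|F| * k.+1 ^ #|V|)%N.
  apply: eE => e eF; rewrite /= andbT inE; split=> //.
  by apply/eqP => eq; have := src_lt_tgt _ eF; rewrite eq ltxx.
have {}xE : (sX * k.+1 ^ 4 = #|crossings| * k.+1 ^ #|V|)%N.
  by apply: xE => -[e g]; rewrite inE => /and3P[eF gF cr]; split=> //; apply: cross_disjoint.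
have {}vE : (sV * k.+1 ^ 1 = #|V| * k.+1 ^ #|V|)%N by apply: vE.
(* Multiplied by the number of samples, all terms become sums over samples with the common factor
   [k.+1 ^ 4], which cancels. *)
rewrite -(@leq_pmul2r (k.+1 ^ #|V|)) ?expn_gt0 // mulnDl -xE.
have -> : (#|F| * k.+1 ^ 2 * k.+1 ^ #|V| = sE * k.+1 ^ 4)%N.
  by rewrite mulnAC -eE -mulnA -expnD.
have -> : (3 * #|V| * k.+1 ^ 3 * k.+1 ^ #|V| = 3 * sV * k.+1 ^ 4)%N.
  by rewrite mulnAC -(mulnA 3) -vE mulnA -mulnA -expnD.
by rewrite -mulnDl leq_pmul2r ?expn_gt0.
Qed.

End CrossingBound.

(** * Arcs of circles *)

Lemma mulr_gt0_trans (R : realDomainType) (x y z : R) :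
  0 < x * y -> 0 < x * z -> 0 < y * z.
Proof.
case: (ltgtP x 0) => [xn|xp|->]; last by rewrite mul0r ltxx.
  by rewrite !(nmulr_rgt0 _ xn) => yn zn; rewrite nmulr_rgt0.
by rewrite !(pmulr_rgt0 _ xp) => yp zp; rewrite mulr_gt0.
Qed.

(** Moving right on an upper half circle is turning clockwise by less than a half turn, so the
    determinant keeps its sign. *)
Lemma arc_orientation (R : realDomainType) (x1 y1 x2 y2 : R) :
  x1 ^+ 2 + y1 ^+ 2 = x2 ^+ 2 + y2 ^+ 2 -> 0 < y1 -> 0 < y2 -> x1 < x2 ->
  0 < y1 * x2 - x1 * y2.
Proof.
move=> n y1p y2p lt.
have [x1n|x1p] := leP x1 0; have [x2n|x2p] := leP x2 0.
- have : y1 < y2 by rewrite ltNge; apply/negP => le; nra.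
  by move=> ?; nra.
- by nra.
- by nra.
- have : y2 < y1 by rewrite ltNge; apply/negP => le; nra.
  by move=> ?; nra.
Qed.

(* A point of the arc is a positive combination of the endpoints. *)
Lemma upper_arc_side (R : realDomainType) (a b x1 y1 x y x2 y2 : R) :
  x1 ^+ 2 + y1 ^+ 2 = x ^+ 2 + y ^+ 2 -> x ^+ 2 + y ^+ 2 = x2 ^+ 2 + y2 ^+ 2 ->
  0 < y1 -> 0 < y -> 0 < y2 -> x1 < x -> x < x2 ->
  0 <= a * x1 + b * y1 -> 0 <= a * x2 + b * y2 ->
  0 < a * x1 + b * y1 + (a * x2 + b * y2) -> 0 < a * x + b * y.
Proof.
move=> n1 n2 y1p yp y2p l1 l2.
set L1 := (_ + _ : R); set L2 := (_ + _ : R) => L1p L2p Lp.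
have c1 := arc_orientation _ _ _ _ _ n1 y1p yp l1.
have c2 := arc_orientation _ _ _ _ _ n2 yp y2p l2.
have c := arc_orientation _ _ _ _ _ (etrans n1 n2) y1p y2p (lt_trans l1 l2).
(* Cramer's rule: the coefficients of the combination are determinants, positive by
   [arc_orientation]. *)
have eq : (y1 * x2 - x1 * y2) * (a * x + b * y) =
    (y * x2 - x * y2) * L1 + (y1 * x - x1 * y) * L2 by rewrite /L1 /L2; ring.
rewrite -(pmulr_rgt0 _ c) eq; clear eq.
have m1 := mulr_ge0 (ltW c2) L1p; have m2 := mulr_ge0 (ltW c1) L2p.
move: L1p; rewrite le_eqVlt => /orP[/eqP L10|L1p].
  by rewrite -L10 add0r in Lp; rewrite ltr_wpDl ?mulr_gt0.
by rewrite ltr_pwDl ?mulr_gt0.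
Qed.

Lemma arc_side (R : realDomainType) (a b x1 y1 x y x2 y2 : R) :
  x1 ^+ 2 + y1 ^+ 2 = x ^+ 2 + y ^+ 2 -> x ^+ 2 + y ^+ 2 = x2 ^+ 2 + y2 ^+ 2 ->
  0 < y1 * y -> 0 < y1 * y2 -> x1 < x -> x < x2 ->
  0 <= a * x1 + b * y1 -> 0 <= a * x2 + b * y2 ->
  0 < a * x1 + b * y1 + (a * x2 + b * y2) -> 0 < a * x + b * y.
Proof.
move=> n1 n2; case: (ltgtP y1 0) => [y1n|y1p|->]; last by rewrite mul0r ltxx.
  rewrite !nmulr_rgt0 // => yn y2n l1 l2.
  rewrite -[b * y1]mulrNN -[b * y2]mulrNN -[b * y]mulrNN.
  by apply: upper_arc_side => //; rewrite ?sqrrN ?oppr_gt0.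
by rewrite !pmulr_rgt0 // => yp y2p l1 l2; apply: upper_arc_side.
Qed.

(** Either the functional or its opposite is positive at both ends, and [arc_side] applies to that
    one. *)
Lemma arc_side_mul (R : realDomainType) (a b x1 y1 x y x2 y2 : R) :
  x1 ^+ 2 + y1 ^+ 2 = x ^+ 2 + y ^+ 2 -> x ^+ 2 + y ^+ 2 = x2 ^+ 2 + y2 ^+ 2 ->
  0 < y1 * y -> 0 < y1 * y2 -> x1 < x -> x < x2 ->
  0 < (a * x1 + b * y1) * (a * x2 + b * y2) ->
  0 < (a * x1 + b * y1) * (a * x + b * y).
Proof.
move=> n1 n2 h1 h2 l1 l2 L.
case: (ltgtP (a * x1 + b * y1) 0) => L1.
- move: L; rewrite !nmulr_rgt0 // => L2.
  have := @arc_side _ (- a) (- b) _ _ _ _ _ _ n1 n2 h1 h2 l1 l2.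
  rewrite !mulNr -!opprD !oppr_ge0 !oppr_gt0; apply; rewrite ?ltW //.
  by rewrite -[X in _ < X]addr0 ltrD.
- move: L; rewrite !pmulr_rgt0 // => L2.
  have := @arc_side _ a b _ _ _ _ _ _ n1 n2 h1 h2 l1 l2.
  by apply; rewrite ?ltW // addr_gt0.
- by rewrite L1 mul0r ltxx in L.
Qed.

(** Two distinct points of an open half circle are linearly independent, so only the zero functional
    vanishes at both. *)
Lemma line_meets_arc_once (R : realDomainType) (a b x1 y1 x2 y2 : R) :
  x1 ^+ 2 + y1 ^+ 2 = x2 ^+ 2 + y2 ^+ 2 -> 0 < y1 * y2 -> x1 < x2 ->
  a * x1 + b * y1 = 0 -> a * x2 + b * y2 = 0 -> a = 0 /\ b = 0.
Proof.
move=> n h lt L1 L2.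
have det : y1 * x2 - x1 * y2 != 0.
  case: (ltgtP y1 0) h => [y1n|y1p|->]; last by rewrite mul0r ltxx.
    rewrite nmulr_rgt0 // => y2n.
    have := @arc_orientation R x1 (- y1) x2 (- y2).
    rewrite !sqrrN !oppr_gt0 => /(_ n y1n y2n lt) p; apply/eqP => E; nra.
  by rewrite pmulr_rgt0 // => y2p; rewrite gt_eqF // arc_orientation.
split; apply: (mulIf det); rewrite mul0r.
  have -> : a * (y1 * x2 - x1 * y2) =
    y1 * (a * x2 + b * y2) - y2 * (a * x1 + b * y1) by ring.
  by rewrite L1 L2 !mulr0 subrr.
have -> : b * (y1 * x2 - x1 * y2) =
  x2 * (a * x1 + b * y1) - x1 * (a * x2 + b * y2) by ring.
by rewrite L1 L2 !mulr0 subrr.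
Qed.

(* Points with these distances are equal or mirror images in the line of centres. *)
Lemma two_circles_inj (R : realFieldType) (u v x1 y1 x2 y2 : R) :
  (u != 0) || (v != 0) ->
  x1 ^+ 2 + y1 ^+ 2 = x2 ^+ 2 + y2 ^+ 2 ->
  (x1 - u) ^+ 2 + (y1 - v) ^+ 2 = (x2 - u) ^+ 2 + (y2 - v) ^+ 2 ->
  0 <= (u * y1 - v * x1) * (u * y2 - v * x2) -> x1 = x2 /\ y1 = y2.
Proof.
move=> uv n1 n2 s.
(* Subtracting [n2] from [n1] gives the inner product with [(u, v)]. Lagrange's identity then gives
   the square of the determinant, and [s] its sign. *)
have dot : u * x1 + v * y1 = u * x2 + v * y2 by nra.
have cr : u * y1 - v * x1 = u * y2 - v * x2.
  have /eqP : (u * y1 - v * x1) ^+ 2 = (u * y2 - v * x2) ^+ 2.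
    have -> : (u * y1 - v * x1) ^+ 2 =
      (u ^+ 2 + v ^+ 2) * (x1 ^+ 2 + y1 ^+ 2) - (u * x1 + v * y1) ^+ 2 by ring.
    by rewrite n1 dot; ring.
  rewrite eqf_sqr => /orP[/eqP//|/eqP E]; move: s; rewrite E.
  set c := (u * y2 - v * x2) => s; have : c ^+ 2 <= 0 by nra.
  by rewrite real_exprn_even_le0 ?num_real //= => /eqP ->; rewrite oppr0.
have N : u ^+ 2 + v ^+ 2 != 0.
  by rewrite paddr_eq0 ?sqr_ge0 // !sqrf_eq0 negb_and.
split; apply: (mulfI N).
  have -> : (u ^+ 2 + v ^+ 2) * x1 = u * (u * x1 + v * y1) - v * (u * y1 - v * x1) by ring.
  by rewrite dot cr; ring.
have -> : (u ^+ 2 + v ^+ 2) * y1 = v * (u * x1 + v * y1) + u * (u * y1 - v * x1) by ring.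
by rewrite dot cr; ring.
Qed.

(** The half circle about the origin through [(x0, y0)], as a function of the abscissa; [Num.sg y0]
    picks the half. As [Num.sqrt] is 0 on negative numbers, it is continuous on the whole line. *)
Definition half_circle (R : rcfType) (x0 y0 x : R) : R :=
  Num.sg y0 * Num.sqrt (x0 ^+ 2 + y0 ^+ 2 - x ^+ 2).

Lemma arc_through (R : rcfType) (x0 y0 x y : R) :
  x0 ^+ 2 + y0 ^+ 2 = x ^+ 2 + y ^+ 2 -> 0 < y0 * y -> half_circle R x0 y0 x = y.
Proof.
move=> n h; have sE : Num.sg y0 = Num.sg y.
  have [yp|yn|y0E] := ltgtP y 0.
  - by rewrite !ltr0_sg //; move: h; rewrite nmulr_lgt0.
  - by rewrite !gtr0_sg //; move: h; rewrite pmulr_lgt0.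
  - by rewrite y0E mulr0 ltxx in h.
by rewrite /half_circle sE n [x ^+ 2 + _]addrC addrK sqrtr_sqr -numEsg.
Qed.

Lemma arc_on_circle (R : rcfType) (x0 y0 x1 y1 x : R) :
  x0 ^+ 2 + y0 ^+ 2 = x1 ^+ 2 + y1 ^+ 2 -> 0 < y0 * y1 -> x0 < x -> x < x1 ->
  x0 ^+ 2 + y0 ^+ 2 = x ^+ 2 + half_circle R x0 y0 x ^+ 2 /\ 0 < y0 * half_circle R x0 y0 x.
Proof.
move=> n h l1 l2.
have y0n : y0 != 0 by apply/eqP => E; rewrite E mul0r ltxx in h.
have y1n : y1 != 0 by apply/eqP => E; rewrite E mulr0 ltxx in h.
have lt : x ^+ 2 < x0 ^+ 2 + y0 ^+ 2.
  have y0p : 0 < y0 ^+ 2 by rewrite exprn_even_gt0.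
  have y1p : 0 < y1 ^+ 2 by rewrite exprn_even_gt0.
  have [xp|xn] := leP 0 x; first by rewrite n; nra.
  by nra.
split.
  rewrite /half_circle exprMn sqr_sg y0n mul1r sqr_sqrtr ?subr_ge0 ?(ltW lt) //.
  by rewrite [RHS]addrC subrK.
by rewrite /half_circle mulrA [y0 * _]mulrC -normrEsg mulr_gt0 ?normr_gt0 // sqrtr_gt0 subr_gt0.
Qed.

Lemma half_circle_continuous (R : realType) (x0 y0 : R) : continuous (half_circle R x0 y0).
Proof.
move=> x; apply: cvgM; first exact: cvg_cst.
apply: (@continuous_comp _ _ _ (fun x : R => x0 ^+ 2 + y0 ^+ 2 - x ^+ 2) Num.sqrt).
  by apply: cvgB; [exact: cvg_cst|exact: exprn_continuous].
exact: sqrt_continuous.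
Qed.

(** The strict bounds will place the zero in the interior of both arcs. *)
Lemma IVT_sign_change (R : realType) (f : R -> R) (a b : R) : continuous f ->
  f a < 0 -> 0 < f b ->
  exists z, [/\ Num.min a b < z, z < Num.max a b & f z = 0].
Proof.
move=> cf fa fb.
have [lt|lt|eq] := ltgtP a b; last by move: fa; rewrite eq ltNge (ltW fb).
- have [|z] := @IVT R f a b 0 (ltW lt) (continuous_subspaceT cf).
    by rewrite ge_min le_max (ltW fa) (ltW fb) orbT.
  rewrite in_itv /= => /andP[l1 l2] fz; exists z; split=> //; rewrite lt_neqAle ?l1 ?l2 andbT;
    by apply/eqP => E; move: fa fb; rewrite -?E ?fz ?E ?fz ltxx.
- have [|z] := @IVT R f b a 0 (ltW lt) (continuous_subspaceT cf).
    by rewrite ge_min le_max (ltW fa) (ltW fb) orbT.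
  rewrite in_itv /= => /andP[l1 l2] fz; exists z; split=> //; rewrite lt_neqAle ?l1 ?l2 andbT;
    by apply/eqP => E; move: fa fb; rewrite -?E ?fz ?E ?fz ltxx.
Qed.

(** * The graph of good arcs and its crossings *)

Section Arcs.
Variables (R : realType) (I J : finType) (D : nat).
Variables (px py : I -> R) (qx qy : J -> R) (lab : I -> J -> 'I_D).

Let sqdist i x y := (x - px i) ^+ 2 + (y - py i) ^+ 2.

Hypothesis centre_inj : forall i i', px i = px i' -> py i = py i' -> i = i'.
Hypothesis qx_inj : injective qx.
Hypothesis lab_sqdist : forall i j j',
  lab i j = lab i j' <-> sqdist i (qx j) (qy j) = sqdist i (qx j') (qy j').

(* The line through the centres [i] and [i'] is the zero set of [side i i']. *)
Let side i i' x y := (px i' - px i) * (y - py i) - (py i' - py i) * (x - px i).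

(** The half circles are open: a point level with the centre is on neither, and is not even related
    to itself. *)
Definition same_half_circle i j j' :=
  (lab i j == lab i j') && (0 < (qy j - py i) * (qy j' - py i)).

Let ctr (e : I * J * J) := e.1.1.
Let src (e : I * J * J) := e.1.2.
Let tgt (e : I * J * J) := e.2.

(** A triple of centre, left end and right end. Testing the two ends against each line of centres
    suffices, because an arc of a half circle with both ends strictly on one side of a line through
    its centre stays there. *)
Definition good_arc (e : I * J * J) :=
  [&& qx (src e) < qx (tgt e), same_half_circle (ctr e) (src e) (tgt e),
    [forall i', (i' != ctr e) ==>
      (0 < side (ctr e) i' (qx (src e)) (qy (src e)) *
           side (ctr e) i' (qx (tgt e)) (qy (tgt e)))]
  & [forall j, ~~ [&& qx (src e) < qx j, qx j < qx (tgt e) &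
      same_half_circle (ctr e) (src e) j]]].

Let height e x := py (ctr e) +
  half_circle R (qx (src e) - px (ctr e)) (qy (src e) - py (ctr e)) (x - px (ctr e)).

Let over e z := (qx (src e) < z) && (z < qx (tgt e)).

Let meet e g z := [&& over e z, over g z & height e z == height g z].

(** Equal centres are excluded since two such good arcs that meet coincide. *)
Let cross e g := (ctr e != ctr g) && `[< exists z, meet e g z >].

Let side_uniq i i' x y x' y' : i' != i ->
  sqdist i x y = sqdist i x' y' -> sqdist i' x y = sqdist i' x' y' ->
  0 <= side i i' x y * side i i' x' y' -> x = x' /\ y = y'.
Proof.
move=> ne n1 n2 s.
have [||||/addIr -> /addIr ->//] := @two_circles_inj R (px i' - px i) (py i' - py i)
  (x - px i) (y - py i) (x' - px i) (y' - py i); rewrite //.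
- rewrite !subr_eq0 -negb_and; apply: contra ne => /andP[/eqP ? /eqP ?].
  by apply/eqP; apply: centre_inj.
- have E a b c : a - b - (c - b) = a - c :> R by ring.
  by rewrite !E.
Qed.

Let good_lt e : good_arc e -> qx (src e) < qx (tgt e).
Proof. by case/and4P. Qed.

Let good_half e : good_arc e -> same_half_circle (ctr e) (src e) (tgt e).
Proof. by case/and4P. Qed.

Let good_side e i' : good_arc e -> i' != ctr e ->
  0 < side (ctr e) i' (qx (src e)) (qy (src e)) *
      side (ctr e) i' (qx (tgt e)) (qy (tgt e)).
Proof. by case/and4P => _ _ /forallP/(_ i')/implyP. Qed.

Let good_empty e j : good_arc e -> qx (src e) < qx j -> qx j < qx (tgt e) ->
  ~~ same_half_circle (ctr e) (src e) j.
Proof. by case/and4P => _ _ _ /forallP/(_ j) + l1 l2; rewrite l1 l2. Qed.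

Let half_sqdist i j j' : same_half_circle i j j' ->
  sqdist i (qx j) (qy j) = sqdist i (qx j') (qy j').
Proof. by case/andP => /eqP/lab_sqdist. Qed.

Let halfI i j j' : sqdist i (qx j) (qy j) = sqdist i (qx j') (qy j') ->
  0 < (qy j - py i) * (qy j' - py i) -> same_half_circle i j j'.
Proof. by move=> /lab_sqdist/eqP n h; rewrite /same_half_circle n. Qed.

Let height_src e : good_arc e -> height e (qx (src e)) = qy (src e).
Proof.
move=> ge; rewrite /height (@arc_through _ _ _ _ (qy (src e) - py (ctr e))) //.
  by rewrite addrC subrK.
have /andP[_] := good_half _ ge.
case: (ltgtP (qy (src e) - py (ctr e)) 0) => [n _|p _|->]; last by rewrite mul0r ltxx.
  by rewrite nmulr_rgt0.
by rewrite mulr_gt0.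
Qed.

Let height_tgt e : good_arc e -> height e (qx (tgt e)) = qy (tgt e).
Proof.
move=> ge; rewrite /height (@arc_through _ _ _ _ (qy (tgt e) - py (ctr e))) //.
- by rewrite addrC subrK.
- exact: half_sqdist (good_half _ ge).
- by have /andP[] := good_half _ ge.
Qed.

Let height_point e z : good_arc e -> over e z ->
  [/\ sqdist (ctr e) z (height e z) = sqdist (ctr e) (qx (src e)) (qy (src e)),
    0 < (qy (src e) - py (ctr e)) * (height e z - py (ctr e))
  & forall i', i' != ctr e ->
    0 < side (ctr e) i' (qx (src e)) (qy (src e)) * side (ctr e) i' z (height e z)].
Proof.
move=> ge /andP[l1 l2].
have /andP[_ h] := good_half _ ge.
have n := half_sqdist _ _ _ (good_half _ ge).
have hE : height e z - py (ctr e) =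
  half_circle R (qx (src e) - px (ctr e)) (qy (src e) - py (ctr e)) (z - px (ctr e)).
  by rewrite /height addrC addKr.
have [] := @arc_on_circle R _ _ _ _ (z - px (ctr e)) n h.
- by rewrite ltrD2r.
- by rewrite ltrD2r.
rewrite -hE => n1 h1; split=> // i' ne.
have sE x y : side (ctr e) i' x y =
   - (py i' - py (ctr e)) * (x - px (ctr e)) + (px i' - px (ctr e)) * (y - py (ctr e)).
  by rewrite /side; ring.
rewrite !sE; apply: (@arc_side_mul R _ _ _ _ _ _
  (qx (tgt e) - px (ctr e)) (qy (tgt e) - py (ctr e))) => //.
- by rewrite -n1; exact: n.
- by rewrite ltrD2r.
- by rewrite ltrD2r.
- by rewrite -!sE; apply: good_side.
Qed.

Let half_eqr i a b c : same_half_circle i a b -> same_half_circle i a c ->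
  same_half_circle i b c.
Proof.
move=> /andP[/eqP e1 h1] /andP[/eqP e2 h2].
rewrite /same_half_circle -e1 e2 eqxx /=.
exact: mulr_gt0_trans h1 h2.
Qed.

(** The common point puts both arcs on the same half circle, and arcs between consecutive points
    cannot overlap unless they are equal. *)
Let meet_same_centre e g z : good_arc e -> good_arc g -> ctr e = ctr g ->
  meet e g z -> e = g.
Proof.
move=> ge gg ce /and3P[oe og /eqP hE].
have [n1 h1 _] := height_point _ _ ge oe.
have [n2 h2 _] := height_point _ _ gg og.
have H : same_half_circle (ctr e) (src e) (src g).
  apply: halfI; first by rewrite -n1 {2}ce -n2 hE ce.
  rewrite mulrC in h1; rewrite mulrC -hE -ce in h2.
  exact: mulr_gt0_trans h1 h2.
have He := half_eqr _ _ _ _ (good_half _ ge) H.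
have Hg := good_half _ gg; rewrite -ce in Hg.
have H' : same_half_circle (ctr e) (src g) (src e).
  by move: H; rewrite /same_half_circle eq_sym mulrC.
have Ht := half_eqr _ _ _ _ H' Hg.
move/andP: oe => [e1 e2]; move/andP: og => [g1 g2].
have sE : src e = src g.
  apply: qx_inj; case: (ltgtP (qx (src e)) (qx (src g))) => // lt.
    by have := good_empty _ _ ge lt (lt_trans g1 e2); rewrite H.
  by have := good_empty _ _ gg lt (lt_trans e1 g2); rewrite -ce H'.
have tE : tgt e = tgt g.
  apply: qx_inj; case: (ltgtP (qx (tgt e)) (qx (tgt g))) => // lt.
    have := good_empty _ _ gg (lt_trans g1 e2) lt.
    by rewrite -ce -sE (good_half _ ge).
  have := good_empty _ _ ge (lt_trans e1 g2) lt.
  by rewrite sE Hg.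
by move: e g ce sE tE {ge gg n1 h1 n2 h2 H He Hg H' Ht e1 e2 g1 g2 hE}
  => [[i a] b] [[i' a'] b']; rewrite /ctr /src /tgt /= => -> -> ->.
Qed.

Let endpoint e v z : good_arc e -> over e z -> v \in [:: src e; tgt e] ->
  [/\ sqdist (ctr e) (qx v) (qy v) = sqdist (ctr e) z (height e z),
    qx v != z
  & forall i', i' != ctr e ->
    0 < side (ctr e) i' (qx v) (qy v) * side (ctr e) i' z (height e z)].
Proof.
move=> ge oe; have [n h s] := height_point _ _ ge oe.
have /andP[l1 l2] := oe.
rewrite !inE => /orP[] /eqP ->; split=> //.
- by rewrite lt_eqF.
- by rewrite n; symmetry; exact: half_sqdist (good_half _ ge).
- by rewrite gt_eqF.
- move=> i' ne; exact: mulr_gt0_trans (good_side _ _ ge ne) (s _ ne).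
Qed.

(** A common end and the meeting point would be two common points of the circles on one side of the
    line of centres. *)
Let meet_no_common_endpoint e g z v : good_arc e -> good_arc g ->
  ctr g != ctr e -> meet e g z ->
  v \in [:: src e; tgt e] -> v \in [:: src g; tgt g] -> False.
Proof.
move=> ge gg ne /and3P[oe og /eqP hE] ve vg.
have [n1 vz s1] := endpoint _ _ _ ge oe ve.
have [n2 _ _] := endpoint _ _ _ gg og vg; rewrite -hE in n2.
have [E _] := side_uniq _ _ _ _ _ _ ne n1 n2 (ltW (s1 _ ne)).
by rewrite E eqxx in vz.
Qed.

Let cross_disjoint e g : good_arc e -> good_arc g -> cross e g ->
  uniq [:: src e; tgt e; src g; tgt g].
Proof.
move=> ge gg /andP[ne /asboolP[z mz]]; rewrite eq_sym in ne.
have dis u v : u \in [:: src e; tgt e] -> v \in [:: src g; tgt g] -> u != v.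
  move=> ue vg; apply/eqP => E; subst v.
  exact: meet_no_common_endpoint ge gg ne mz ue vg.
have st h : good_arc h -> src h != tgt h.
  by move=> /good_lt lt; apply/eqP => E; rewrite E ltxx in lt.
by rewrite /= !inE !negb_or !st // !dis ?inE ?eqxx ?orbT.
Qed.

Let edge_avoids e v : good_arc e -> qx (src e) < qx v -> qx v < qx (tgt e) ->
  height e (qx v) <> qy v.
Proof.
move=> ge l1 l2 E; have [|n h _] := height_point _ (qx v) ge; first exact/andP.
have := good_empty _ _ ge l1 l2; rewrite halfI //; first by rewrite -n E.
by rewrite -E.
Qed.

(** With different centres, the two ends would be common points of both circles on one side of the
    line of centres, hence equal. *)
Let edge_simple e g : good_arc e -> good_arc g ->
  src e = src g -> tgt e = tgt g -> e = g.
Proof.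
move=> ge gg sE tE; have [cE|/eqP ne] := ctr g =P ctr e.
  by move: e g sE tE cE {ge gg} => [[i a] b] [[i' a'] b']; rewrite /ctr /src /tgt /= => -> -> ->.
have n1 := half_sqdist _ _ _ (good_half _ ge).
have n2 := half_sqdist _ _ _ (good_half _ gg); rewrite -sE -tE in n2.
have [E _] := side_uniq _ _ _ _ _ _ ne n1 n2 (ltW (good_side _ _ ge ne)).
by have := good_lt _ ge; rewrite E ltxx.
Qed.

Let height_continuous e : continuous (height e).
Proof.
move=> x; apply: cvgD; first exact: cvg_cst.
apply: (@continuous_comp _ _ _ (fun x : R => x - px (ctr e))).
  by apply: cvgB; [exact: cvg_id|exact: cvg_cst].
exact: half_circle_continuous.
Qed.

(** A reversal of the order yields a common interior point by continuity, which is a crossing unless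
    the centres, hence the arcs, agree. *)
Let height_order e g v w : good_arc e -> good_arc g -> ~~ cross e g ->
  qx (src e) <= qx v <= qx (tgt e) -> qx (src g) <= qx v <= qx (tgt g) ->
  qx (src e) <= qx w <= qx (tgt e) -> qx (src g) <= qx w <= qx (tgt g) ->
  height e (qx v) < height g (qx v) -> height e (qx w) <= height g (qx w).
Proof.
move=> ge gg nc /andP[v1 v2] /andP[v3 v4] /andP[w1 w2] /andP[w3 w4] lt.
rewrite leNgt; apply/negP => gt.
have cf : continuous (fun x => height e x - height g x).
  by move=> x; apply: cvgB; exact: height_continuous.
have fv : height e (qx v) - height g (qx v) < 0 by rewrite subr_lt0.
have fw : 0 < height e (qx w) - height g (qx w) by rewrite subr_gt0.
have [z [z1 z2 fz]] := IVT_sign_change _ _ _ _ cf fv fw.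
have mz : meet e g z.
  apply/and3P; split; last by rewrite -subr_eq0 fz.
  - by apply/andP; split; [apply: le_lt_trans z1; rewrite le_min v1 w1|
      apply: lt_le_trans z2 _; rewrite ge_max v2 w2].
  - by apply/andP; split; [apply: le_lt_trans z1; rewrite le_min v3 w3|
      apply: lt_le_trans z2 _; rewrite ge_max v4 w4].
have [cE|/eqP ne] := ctr e =P ctr g.
  by have E := meet_same_centre _ _ _ ge gg cE mz; rewrite E ltxx in lt.
by case/negP: nc; rewrite /cross ne; apply/asboolP; exists z.
Qed.

Let height_inj e g v : good_arc e -> good_arc g -> ~~ cross e g ->
  qx (src e) < qx v < qx (tgt e) -> qx (src g) < qx v < qx (tgt g) ->
  height e (qx v) = height g (qx v) -> e = g.
Proof.
move=> ge gg nc o1 o2 E.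
have mz : meet e g (qx v) by apply/and3P; split=> //; apply/eqP.
have [cE|/eqP ne] := ctr e =P ctr g; first exact: meet_same_centre mz.
by case/negP: nc; rewrite /cross ne; apply/asboolP; exists (qx v).
Qed.

Let good_arcs := [set e | good_arc e].

Let crossings :=
  [set eg : _ * _ | [&& eg.1 \in good_arcs, eg.2 \in good_arcs & cross eg.1 eg.2]].

(* A crossing is determined by its two circles and by the side of the line of
   centres on which it lies. *)
Let card_crossings : (#|crossings| <= 2 * (#|I| * D) ^ 2)%N.
Proof.
pose code (eg : (I * J * J) * (I * J * J)) (c : (I * 'I_D) * (I * 'I_D) * bool) :=
  exists2 z, meet eg.1 eg.2 z &
    c = ((ctr eg.1, lab (ctr eg.1) (src eg.1)), (ctr eg.2, lab (ctr eg.2) (src eg.2)),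
         0 < side (ctr eg.1) (ctr eg.2) z (height eg.1 z)).
have -> : (2 * (#|I| * D) ^ 2 = #|[set: (I * 'I_D) * (I * 'I_D) * bool]|)%N.
  by rewrite cardsT !card_prod card_ord card_bool mulnC mulnn.
apply: (@leq_card_rel _ _ _ _ code).
  move=> [e g]; rewrite inE /= => /and3P[_ _ /andP[_ /asboolP[z mz]]].
  by eexists; last (by exists z); rewrite inE.
move=> [e g] [e' g'] c; rewrite !inE /= => /and3P[ge gg /andP[ne _]] /and3P[ge' gg' _].
move=> [z /= mz cE] [z' /= mz' cE']; rewrite {}cE in cE'.
case: cE' => c1 l1 c2 l2 s.
rewrite -c1 in l1 s; rewrite -c2 in l2 s.
have /and3P[oe og /eqP h] := mz; have /and3P[oe' og' /eqP h'] := mz'.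
rewrite eq_sym in ne.
have [n1 _ s1] := height_point _ _ ge oe; have [n2 _ _] := height_point _ _ gg og.
have [n1' _ s1'] := height_point _ _ ge' oe'; have [n2' _ _] := height_point _ _ gg' og'.
rewrite -c1 in n1' s1'; rewrite -c2 -h' in n2'; rewrite -h in n2.
have /side_uniq : ctr g != ctr e by [].
move=> /(_ z (height e z) z' (height e' z')) [].
- by rewrite n1 n1'; apply/lab_sqdist.
- by rewrite n2 n2'; apply/lab_sqdist.
- have := s1 _ ne; have := s1' _ ne.
  case: (ltgtP 0 (side _ _ z _)) s => [p|p|<-]; last by rewrite mul0r.
    by move=> /esym p' _ _; rewrite mulr_ge0 // ltW.
  move=> /esym/negbT; rewrite -leNgt => p' _ _; by rewrite mulr_le0 // ltW.
(* Both crossings occur at the same point, and a good arc is determined by its centre and an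
   interior point. *)
move=> zE hE; subst z'; congr pair.
  by apply: (meet_same_centre _ _ z) => //; apply/and3P; split=> //; apply/eqP.
apply: (meet_same_centre _ _ z) => //; apply/and3P; split=> //.
by rewrite -h -h' hE.
Qed.

Lemma good_arc_crossing_bound (k : nat) : (0 < k)%N ->
  (#|[set e | good_arc e]| * k ^ 2 <= 3 * #|J| * k ^ 3 + 2 * (#|I| * D) ^ 2)%N.
Proof.
move=> k0; apply: (leq_trans _ (leq_add (leqnn _) card_crossings)).
have gE e : e \in good_arcs -> good_arc e by rewrite inE.
apply: (@crossing_lemma _ R J _ qx qy src tgt (fun e v => height e (qx v))) => //.
- by move=> e /gE /good_lt.
- by move=> e /gE /height_src.
- by move=> e /gE /height_tgt.
- by move=> e v /gE; apply: edge_avoids.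
- by move=> e g /gE ge /gE; apply: edge_simple.
- by move=> e g v w /gE ge /gE; apply: height_order.
- by move=> e g v /gE ge /gE; apply: height_inj.
- by move=> e g /gE ge /gE; apply: cross_disjoint.
Qed.

(** A point is determined by its distances to two centres and its side of their line. *)
Lemma card_two_centres : (2 <= #|I|)%N -> (#|J| <= 2 * D ^ 2)%N.
Proof.
move=> /card_gt1P[i [i' [_ _ ne]]]; rewrite eq_sym in ne.
have -> : (2 * D ^ 2 = #|[set: 'I_D * 'I_D * bool]|)%N.
  by rewrite cardsT !card_prod card_ord card_bool mulnC mulnn.
rewrite -cardsT; apply: (@leq_card_rel _ _ _ _ (fun j c =>
  c = (lab i j, lab i' j, 0 <= side i i' (qx j) (qy j)))).
  by move=> j _; eexists; last by []; rewrite inE.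
move=> j j' c _ _ -> [/lab_sqdist n1 /lab_sqdist n2 s].
have [|E _] := side_uniq _ _ _ _ _ _ ne n1 n2; last exact: qx_inj.
case: (leP 0 (side i i' (qx j) _)) s => [p|p].
  by move=> /esym p'; rewrite mulr_ge0.
by move=> /esym/negbT; rewrite -ltNge => p'; rewrite mulr_le0 // ltW.
Qed.

(** * Counting the lost incidences *)

Let half_sym i a b : same_half_circle i a b -> same_half_circle i b a.
Proof. by rewrite /same_half_circle eq_sym mulrC. Qed.

Let arc_side_pos i i' (c : R) a j b :
  same_half_circle i a j -> same_half_circle i a b ->
  qx a < qx j -> qx j < qx b ->
  0 < c * side i i' (qx a) (qy a) -> 0 <= c * side i i' (qx b) (qy b) ->
  0 < c * side i i' (qx j) (qy j).
Proof.
move=> haj hab l1 l2.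
have n1 := half_sqdist _ _ _ haj.
have n2 := half_sqdist _ _ _ (half_eqr _ _ _ _ haj hab).
have /andP[_ h1] := haj; have /andP[_ h2] := hab.
have sE x y : c * side i i' x y =
   - c * (py i' - py i) * (x - px i) + c * (px i' - px i) * (y - py i).
  by rewrite /side; ring.
rewrite !sE => sa sb.
apply: (@arc_side R _ _ _ _ _ _ _ _ n1 n2) => //; rewrite ?ltrD2r ?(ltW sa) //.
by rewrite ltr_pwDl.
Qed.

Let side_zero_once i i' a b : i' != i -> same_half_circle i a b ->
  qx a < qx b -> side i i' (qx a) (qy a) = 0 -> side i i' (qx b) (qy b) <> 0.
Proof.
move=> ne hab lt.
have n := half_sqdist _ _ _ hab; have /andP[_ h] := hab.
have sE x y : side i i' x y = - (py i' - py i) * (x - px i) + (px i' - px i) * (y - py i).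
  by rewrite /side; ring.
rewrite !sE => sa sb.
have lt' : qx a - px i < qx b - px i by rewrite ltrD2r.
have [/eqP + /eqP] := line_meets_arc_once _ _ _ _ _ _ _ n h lt' sa sb.
rewrite oppr_eq0 !subr_eq0 => /eqP e2 /eqP e1.
by case/eqP: ne; apply: centre_inj.
Qed.

Let succ i j b := [/\ qx j < qx b, same_half_circle i j b &
  forall b', qx j < qx b' -> same_half_circle i j b' -> qx b <= qx b'].

(* Along a half circle a linear functional changes sign at most once. *)
Let sign_change_uniq i i' j b j' b' : i' != i ->
  same_half_circle i j j' -> qx j < qx j' -> succ i j b -> succ i j' b' ->
  side i i' (qx j) (qy j) * side i i' (qx b) (qy b) <= 0 ->
  side i i' (qx j') (qy j') * side i i' (qx b') (qy b') <= 0 ->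
  (side i i' (qx j) (qy j) == 0) <> (side i i' (qx j') (qy j') == 0).
Proof.
move=> ne hj lt [lb hb bmin] [lb' hb' _]; set c := side i i' (qx j) (qy j).
set c' := side i i' (qx j') (qy j') => cb cb' E.
have [c0|cn0] := eqVneq c 0.
  move: E; rewrite c0 eqxx => /esym/eqP c'0.
  exact: side_zero_once ne hj lt c0 c'0.
have c'n0 : c' != 0 by rewrite -E.
have cc : 0 < c * c by rewrite -expr2 exprn_even_gt0.
(* The change of sign after [j] occurs no later than [j']: otherwise [b] would be [j'] or lie
   between two points of one strict side. *)
have cc' : c * c' < 0.
  rewrite lt_neqAle mulf_neq0 //= leNgt; apply/negP => p.
  have := bmin _ lt hj; rewrite le_eqVlt => /orP[/eqP/qx_inj bE|lbj].
    by move: cb; rewrite bE -/c' leNgt p.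
  have := arc_side_pos i i' c j b j' hb hj lb lbj cc (ltW p).
  by rewrite ltNge cb.
(* A second change after [j'] brings [b'] back to the side of [j], although [j'], between them, is
   on the other side. *)
have cb0 : 0 <= c * side i i' (qx b') (qy b').
  have c'2 : 0 < c' * c' by rewrite -expr2 exprn_even_gt0.
  rewrite leNgt; apply/negP => p.
  have : 0 < (c * c') * (c * side i i' (qx b') (qy b')) by rewrite nmulr_rgt0.
  rewrite mulrACA pmulr_rgt0 //; rewrite ltNge cb' //.
have hjb : same_half_circle i j b' by exact: half_eqr (half_sym _ _ _ hj) hb'.
have := arc_side_pos i i' c j j' b' hj hjb lt lb' cc cb0.
by rewrite ltNge (ltW cc').
Qed.

Let ex_succ i j b : qx j < qx b -> same_half_circle i j b -> exists b', succ i j b'.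
Proof.
move=> lt h; pose P b := (qx j < qx b) && same_half_circle i j b.
have P0 : P b by apply/andP.
case: (@arg_minP _ _ _ b P qx P0) => b' /andP[lt' h'] bmin.
by exists b'; split=> // b'' l2 h2; apply: bmin; apply/andP.
Qed.

(** Genericity: a point level with a centre coincides with it, so each centre loses at most one
    incidence in this way. *)
Hypothesis qy_neq_py : forall i j, qy j = py i -> qx j = px i.

Let same_code i j j' : qy j <> py i -> qy j' <> py i -> lab i j = lab i j' ->
  (py i < qy j) = (py i < qy j') -> same_half_circle i j j'.
Proof.
move=> /eqP n /eqP n' l E; rewrite /same_half_circle l eqxx /=.
case: (ltgtP (py i) (qy j)) E n => [p|p|->]; rewrite ?eqxx // => /esym E _.
  by rewrite mulr_gt0 // subr_gt0.
move: n'; rewrite neq_lt E orbF => p'.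
by rewrite nmulr_rgt0 ?subr_lt0.
Qed.

(** An incidence starts a good arc ([A1]), is level with the centre ([A2]), is the last on one of
    the [2 m D] half circles ([A3]), or its arc to the next point fails the test for some line of
    centres ([A4]). By [sign_change_uniq] a half circle and a line account for at most two failures,
    told apart by whether the starting point is on the line. *)
Lemma card_good_arcs : (#|I| * #|J| <=
  #|[set e | good_arc e]| + #|I| + 2 * #|I| * D + 4 * #|I| ^ 2 * D)%N.
Proof.
pose A1 := [set s : I * J | `[< exists b, good_arc (s.1, s.2, b) >]].
pose A2 := [set s : I * J | qy s.2 == py s.1].
pose A3 := [set s : I * J | (qy s.2 != py s.1) &&
  `[< forall b, qx s.2 < qx b -> ~ same_half_circle s.1 s.2 b >]].
pose r4 (s : I * J) (c : I * 'I_D * bool * I * bool) := exists b i',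
  [/\ succ s.1 s.2 b, i' != s.1,
    side s.1 i' (qx s.2) (qy s.2) * side s.1 i' (qx b) (qy b) <= 0 &
    c = (s.1, lab s.1 s.2, py s.1 < qy s.2, i', side s.1 i' (qx s.2) (qy s.2) == 0)].
pose A4 := [set s : I * J | (qy s.2 != py s.1) && `[< exists c, r4 s c >]].
have sub : [set: I * J] \subset A1 :|: A2 :|: A3 :|: A4.
  apply/subsetP => -[i j] _; rewrite !inE /=.
  have [/=|ny] := eqVneq (qy j) (py i); first by rewrite orbT.
  rewrite orbF /= -!asbool_or; apply/asboolP.
  have [[b lb]|no] := pselect (exists2 b, qx j < qx b & same_half_circle i j b); last first.
    by left; right => b lb hb; apply: no; exists b.
  move=> hb; have [b' sb] := ex_succ _ _ _ lb hb.
  have [lb' hb' bmin] := sb.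
  have [g|ng] := boolP (good_arc (i, j, b')); first by left; left; exists b'.
  right; move: ng; rewrite /good_arc /ctr /src /tgt /= lb' hb' /= negb_and.
  case/orP => [/forallPn[i']|/forallPn[j']].
    rewrite negb_imply -leNgt => /andP[ne le0].
    by eexists; exists b', i'; split.
  rewrite negbK => /and3P[l1 l2 hj'].
  by have := bmin _ l1 hj'; rewrite leNgt l2.
have c1 : (#|A1| <= #|[set e | good_arc e]|)%N.
  apply: (@leq_card_rel _ _ _ _ (fun s e => s = (e.1.1, e.1.2))).
    move=> [i j]; rewrite inE => /asboolP[b gb].
    by exists (i, j, b); rewrite ?inE.
  by move=> s s' e _ _ -> ->.
have c2 : (#|A2| <= #|I|)%N.
  rewrite -cardsT; apply: (@leq_card_rel _ _ _ _ (fun s i => s.1 = i)).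
    by move=> s _; exists s.1.
  move=> [i j] [i' j'] i0; rewrite !inE /= => /eqP e /eqP e' ii i'i; subst i i'.
  by congr pair; apply: qx_inj; rewrite !(qy_neq_py i0).
have c3 : (#|A3| <= 2 * #|I| * D)%N.
  have -> : (2 * #|I| * D = #|[set: I * 'I_D * bool]|)%N.
    by rewrite cardsT !card_prod card_ord card_bool; lia.
  apply: (@leq_card_rel _ _ _ _
    (fun s c => c = (s.1, lab s.1 s.2, py s.1 < qy s.2))).
    by move=> s _; eexists; last by []; rewrite inE.
  move=> [i j] [i' j'] c; rewrite !inE /= => /andP[/eqP n /asboolP no].
  move=> /andP[/eqP n' /asboolP no'] -> [iE]; subst i' => l s.
  have h := same_code _ _ _ n n' l s.
  congr pair; apply: qx_inj; case: (ltgtP (qx j) (qx j')) => // lt.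
    by case: (no _ lt).
  by case: (no' _ lt); apply: half_sym.
have c4 : (#|A4| <= 4 * #|I| ^ 2 * D)%N.
  have -> : (4 * #|I| ^ 2 * D = #|[set: I * 'I_D * bool * I * bool]|)%N.
    by rewrite cardsT !card_prod card_ord card_bool; lia.
  apply: (@leq_card_rel _ _ _ _ r4).
    by move=> s; rewrite inE => /andP[_ /asboolP[c rc]]; exists c; rewrite ?inE.
  move=> [i j] [i' j'] c; rewrite !inE /= => /andP[/eqP n _] /andP[/eqP n' _].
  move=> [b [k /= [sb ne le0 ->]]] [b' [k' /= [sb' _ le0' ]]].
  move=> [iE l s kE z]; subst i' k'.
  have h := same_code _ _ _ n n' l s.
  congr pair; apply: qx_inj; case: (ltgtP (qx j) (qx j')) => // lt.
    by case: (sign_change_uniq _ _ _ _ _ _ ne h lt sb sb' le0 le0').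
  by case: (sign_change_uniq _ _ _ _ _ _ ne (half_sym _ _ _ h) lt sb' sb le0' le0).
have cU := fun A B : {set I * J} => leq_of_leqif (leq_card_setU A B).
have -> : (#|I| * #|J| = #|[set: I * J]|)%N by rewrite cardsT card_prod.
apply: leq_trans (subset_leq_card sub) _.
apply: leq_trans (cU _ _) (leq_add _ c4).
apply: leq_trans (cU _ _) (leq_add _ c3).
exact: leq_trans (cU _ _) (leq_add c1 c2).
Qed.

End Arcs.

(** * Counting distances *)

(** A vector excludes at most the slopes [v.1 / v.2] and [- v.2 / v.1], and [t] exceeds the absolute
    values of all of them. A zero denominator contributes 0, which is harmless. *)
Lemma generic_slope (R : realFieldType) (s : seq (R * R)) :
  exists t : R, forall v, v \in s -> v <> 0 ->
    v.1 - t * v.2 != 0 /\ t * v.1 + v.2 != 0.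
Proof.
pose f (v : R * R) := `|v.1 / v.2| + `|v.2 / v.1|.
exists (1 + \sum_(v <- s) f v) => v vs vn.
have f_ge0 u : 0 <= f u by rewrite addr_ge0.
have le : f v <= \sum_(v <- s) f v.
  by rewrite (big_rem _ vs) /= lerDl sumr_ge0.
set t := 1 + _; have lt : f v < t by rewrite (le_lt_trans le) // ltrDr.
case: v vn {vs le} lt => a b vn; rewrite /f /= => lt.
split; apply/eqP => E.
  have aE : a = t * b by lra.
  have bn : b != 0 by apply/eqP => b0; apply: vn; rewrite aE b0 mulr0.
  have : t <= `|a / b| by rewrite aE mulfK // ler_norm.
  by rewrite leNgt => /negP; apply; apply: le_lt_trans lt; rewrite lerDl.
have bE : b = - t * a by lra.
have an : a != 0 by apply/eqP => a0; apply: vn; rewrite bE a0 mulr0.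
have : t <= `|b / a| by rewrite bE mulfK // normrN ler_norm.
by rewrite leNgt => /negP; apply; apply: le_lt_trans lt; rewrite lerDr.
Qed.

(* The similarity (x, y) |-> (x - t y, t x + y) with generic t makes all the
   abscissae, and all the ordinates, distinct. *)
Lemma few_distances_bounds (R : realType) (I J : finType) (D : nat)
    (p : I -> R * R) (q : J -> R * R) (lab : I -> J -> 'I_D) :
  injective p -> injective q ->
  (forall i j j', lab i j = lab i j' <->
    ((p i).1 - (q j).1) ^+ 2 + ((p i).2 - (q j).2) ^+ 2 =
    ((p i).1 - (q j').1) ^+ 2 + ((p i).2 - (q j').2) ^+ 2) ->
  ((2 <= #|I|)%N -> (#|J| <= 2 * D ^ 2)%N) /\
  exists E : nat,
    (#|I| * #|J| <= E + #|I| + 2 * #|I| * D + 4 * #|I| ^ 2 * D)%N /\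
    forall k : nat, (0 < k)%N ->
      (E * k ^ 2 <= 3 * #|J| * k ^ 3 + 2 * (#|I| * D) ^ 2)%N.
Proof.
move=> p_inj q_inj labP.
pose pts := codom p ++ codom q.
have [t tP] := generic_slope R [seq x - y | x <- pts, y <- pts].
pose X (x : R * R) := x.1 - t * x.2; pose Y (x : R * R) := t * x.1 + x.2.
have sepX x y : x \in pts -> y \in pts -> X x = X y -> x = y.
  move=> xp yp E; apply/eqP; rewrite -subr_eq0; apply/eqP; apply: contrapT => ne.
  have [+ _] := tP _ (allpairs_f _ xp yp) ne.
  by move=> /eqP; apply; move: E; rewrite /X /=; lra.
have sepY x y : x \in pts -> y \in pts -> Y x = Y y -> x = y.
  move=> xp yp E; apply/eqP; rewrite -subr_eq0; apply/eqP; apply: contrapT => ne.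
  have [_] := tP _ (allpairs_f _ xp yp) ne.
  by move=> /eqP; apply; move: E; rewrite /Y /=; lra.
have pP i : p i \in pts by rewrite mem_cat codom_f.
have qP j : q j \in pts by rewrite mem_cat codom_f orbT.
have centre_inj i i' : X (p i) = X (p i') -> Y (p i) = Y (p i') -> i = i'.
  by move=> /(sepX _ _ (pP i) (pP i'))/p_inj.
have qx_inj : injective (fun j => X (q j)).
  by move=> j j' /(sepX _ _ (qP j) (qP j'))/q_inj.
have same_y i j : Y (q j) = Y (p i) -> X (q j) = X (p i).
  by move=> /(sepY _ _ (qP j) (pP i)) ->.
have N : 1 + t ^+ 2 != 0 by rewrite gt_eqF // ltr_wpDr // sqr_ge0.
have sq (x y : R * R) : (X y - X x) ^+ 2 + (Y y - Y x) ^+ 2 =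
    (1 + t ^+ 2) * ((x.1 - y.1) ^+ 2 + (x.2 - y.2) ^+ 2).
  by rewrite /X /Y; ring.
have lab_sqdist i j j' : lab i j = lab i j' <->
   (X (q j) - X (p i)) ^+ 2 + (Y (q j) - Y (p i)) ^+ 2 =
   (X (q j') - X (p i)) ^+ 2 + (Y (q j') - Y (p i)) ^+ 2.
  rewrite !sq labP; split=> [->//|]; exact: mulfI.
split; first exact: card_two_centres centre_inj qx_inj lab_sqdist.
exists #|[set e | good_arc R I J D (X \o p) (Y \o p) (X \o q) (Y \o q) lab e]|.
split; first exact: card_good_arcs centre_inj qx_inj lab_sqdist same_y.
move=> k k0; exact: good_arc_crossing_bound centre_inj qx_inj lab_sqdist _ k0.
Qed.

(* The crossing bound is used with k = m %/ 12; for m < 12 two centres suffice. *)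
Lemma distance_count_arith (m n D E : nat) : (2 <= m)%N -> (m ^ 3 <= n)%N ->
  (n <= 2 * D ^ 2)%N ->
  (m * n <= E + m + 2 * m * D + 4 * m ^ 2 * D)%N ->
  (forall k, (0 < k)%N -> (E * k ^ 2 <= 3 * n * k ^ 3 + 2 * (m * D) ^ 2)%N) ->
  (m * n <= (100 * D) ^ 2)%N.
Proof.
move=> m2 mn small many cross; rewrite leqNgt; apply/negP.
have -> : ((100 * D) ^ 2 = 100 * (100 * D ^ 2))%N by rewrite expnMn mulnA.
move=> lt.
have n8 : (2 ^ 3 <= n)%N by apply: leq_trans mn; rewrite leq_exp2r.
rewrite (_ : 2 ^ 3 = 8)%N // in n8.
have [m12|m12] := ltnP m 12.
  have : (m * n <= 12 * n)%N by rewrite leq_mul2r (ltnW m12) orbT.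
  lia.
(* After squaring, this is where [m ^ 3 <= n] enters. *)
have sparse : (100 * (m ^ 2 * D) < m * n)%N.
  rewrite -(@ltn_exp2r _ _ 2) //.
  have -> : ((100 * (m ^ 2 * D)) ^ 2 = m ^ 4 * (100 * (100 * D ^ 2)))%N.
    by rewrite !expnS !expn0; ring.
  apply: (@leq_trans (m ^ 4 * (m * n))); first by rewrite ltn_pmul2l // expn_gt0; lia.
  have -> : (m ^ 4 * (m * n) = (m ^ 2 * n) * m ^ 3)%N by rewrite !expnS expn0; ring.
  have -> : ((m * n) ^ 2 = (m ^ 2 * n) * n)%N by rewrite !expnS expn0; ring.
  by rewrite leq_mul2l mn orbT.
(* The loss is at most [m n / 8] from the term [m], plus [5 m ^ 2 D], which is below [m n / 20]. *)
have E_big : (m * n <= 2 * E)%N.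
  have : (2 * m * D <= m ^ 2 * D)%N by rewrite leq_mul2r -mulnn leq_mul2r m2 !orbT.
  have : (8 * m <= m * n)%N by rewrite mulnC leq_mul2l n8 orbT.
  lia.
(* With [12 k <= m] the term [3 n k ^ 3] is at most half of [E k ^ 2], so the crossings must account
   for the rest. *)
pose k := (m %/ 12)%N.
have k0 : (0 < k)%N by rewrite divn_gt0.
have km : (12 * k <= m)%N by rewrite mulnC leq_trunc_div.
have mk : (m <= 24 * k)%N by rewrite /k; lia.
have := cross k k0.
have : (m * n * k ^ 2 <= 2 * E * k ^ 2)%N by rewrite leq_mul2r E_big orbT.
have : (12 * (n * k ^ 3) <= m * n * k ^ 2)%N.
  have -> : (12 * (n * k ^ 3) = (12 * k) * (n * k ^ 2))%N by rewrite !expnS expn0; ring.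
  by rewrite -(mulnA m) leq_mul2r km orbT.
move=> h1 h2 h3.
have h4 : (m * (n * k ^ 2) <= m * (8 * m * D ^ 2))%N.
  have -> : (m * (8 * m * D ^ 2) = 8 * (m * D) ^ 2)%N by rewrite !expnS !expn0; ring.
  by rewrite mulnA; lia.
have h5 : (n * k ^ 2 <= 8 * m * D ^ 2)%N.
  by move: h4; rewrite leq_pmul2l //; lia.
have h6 : (n * (100 * (100 * k ^ 2)) < n * (8 * m ^ 2))%N.
  apply: (@leq_ltn_trans (8 * m * (100 * (100 * D ^ 2)))); first by lia.
  apply: (@leq_trans (8 * m * (m * n))); first by rewrite ltn_pmul2l //; lia.
  by rewrite (_ : 8 * m * (m * n) = n * (8 * m ^ 2))%N // !expnS expn0; ring.
(* Incompatible with [m <= 24 k], since [8 * 24 ^ 2 = 4608]. *)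
have h7 : (100 * (100 * k ^ 2) < 8 * m ^ 2)%N by move: h6; rewrite ltn_pmul2l //; lia.
have : (m ^ 2 <= (24 * k) ^ 2)%N by rewrite leq_exp2r.
rewrite expnMn; lia.
Qed.

Theorem theorem3p6 (R : realType) :
  exists c : R, 0 < c /\
    forall (m n : nat) (P Q : {fset R * R}),
      #|` P | = m -> #|` Q | = n ->
      (2 <= m)%N -> m%:R <= n%:R `^ (3%:R^-1) :> R ->
      exists2 p : R * R, p \in P &
        c * Num.sqrt (m%:R * n%:R) <= (#|` [fset eucl_dist p q | q in Q] |)%:R.
Proof.
exists (100%:R^-1); split; first by rewrite invr_gt0 ltr0n.
move=> m n P Q cP cQ m2 mn.
have mn3 : (m ^ 3 <= n)%N.
  rewrite -(ler_nat R) natrX.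
  have -> : (n%:R : R) = (n%:R `^ (3%:R^-1)) ^+ 3.
    by rewrite -powR_mulrn ?powR_ge0 // -powRrM mulVf ?pnatr_eq0 // powRr1.
  by rewrite lerXn2r ?nnegrE ?powR_ge0.
pose dists (i : P) := [fset eucl_dist (val i) q | q in Q].
have [p0 p0P] : exists p0, p0 \in P.
  have : P != fset0 by rewrite -cardfs_gt0 cP; lia.
  by case/fset0Pn => p0; exists p0.
(* The witness sees the most distances, so that the positions of the distances from any centre in
   their enumeration fit into ['I_D]. *)
case: (@arg_maxnP P [` p0P] xpredT (fun i => #|` dists i|) isT) => i0 _ imax.
set D := #|` dists i0| in imax.
have labD (i : P) (j : Q) : (index (eucl_dist (val i) (val j)) (dists i) < D)%N.
  apply: leq_trans (imax i isT); rewrite index_mem.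
  by apply/imfsetP; exists (val j) => //; apply: valP.
pose lab i j := Ordinal (labD i j).
have labP i j j' : lab i j = lab i j' <->
    ((val i).1 - (val j).1) ^+ 2 + ((val i).2 - (val j).2) ^+ 2 =
    ((val i).1 - (val j').1) ^+ 2 + ((val i).2 - (val j').2) ^+ 2 :> R.
  have mem (k : Q) : eucl_dist (val i) (val k) \in dists i.
    by apply/imfsetP; exists (val k) => //; apply: valP.
  split=> [/(congr1 val)/= /(index_inj 0 (mem j) (mem j'))/eqP|E].
    by rewrite eqr_sqrt ?addr_ge0 ?sqr_ge0 // => /eqP.
  by apply: val_inj; rewrite /= /eucl_dist E.
have [small [E [many cross]]] := few_distances_bounds R P Q D val val lab val_inj val_inj labP.
rewrite -!cardfE cP cQ in small many cross.
have le := distance_count_arith _ _ _ _ m2 mn3 (small m2) many cross.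
exists (val i0); first exact: valP.
rewrite mulrC ler_pdivrMr ?ltr0n // -[leRHS]ger0_norm ?mulr_ge0 // -sqrtr_sqr.
rewrite ler_sqrt ?sqr_ge0 // -!natrM -natrX ler_nat.
by rewrite [(_ * 100)%N]mulnC.
Qed.
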